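(* Let $\mathcal{M}=(\mathcal{S},\mathcal{A},f,r,\gamma)$ and $\hat{\mathcal{M}}=(\mathcal{S},\mathcal{A},\hat f,\hat r,\gamma)$ be Markov decision processes sharing $\mathcal{S},\mathcal{A},\gamma$, with deterministic dynamics $f,\hat f:\mathcal{S}\times\mathcal{A}\to\mathcal{S}$ and rewards $r,\hat r:\mathcal{S}\times\mathcal{A}\to\mathbb{R}$. Assume that there are constants $L_f,L_r\ge 0$ such that for all $s,s'\in\mathcal{S}$, $a,a'\in\mathcal{A}$, $$\|f(s,a)-f(s',a')\|\le L_f(\|s-s'\|+\|a-a'\|),\qquad |r(s,a)-r(s',a')|\le L_r(\|s-s'\|+\|a-a'\|).$$ Let $L_\pi\ge 0$ and assume $\gamma L_f(1+L_\pi)<1$. Set $\varepsilon_{\mathrm{dyn}}:=\sup_{s,a}\|\hat f(s,a)-f(s,a)\|$ and $\varepsilon_{\mathrm{rew}}:=\sup_{s,a}|\hat r(s,a)-r(s,a)|$, both assumed finite. Then for every policy $\pi:\mathcal{S}\to\mathcal{A}$ that is $L_\pi$-Lipschitz (i.e. $\|\pi(s)-\pi(s')\|\le L_\pi\|s-s'\|$ for all $s,s'$) and every common initial state $s_0\in\mathcal{S}$, $$\left|J(\pi,\mathcal{M})-J(\pi,\hat{\mathcal{M}})\right|\le \frac{1}{1-\gamma}\,\varepsilon_{\mathrm{rew}}+\frac{\gamma L_r(1+L_\pi)}{(1-\gamma)(1-\gamma L_f(1+L_\pi))}\,\varepsilon_{\mathrm{dyn}}.$$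
   Context: $\mathcal{S}\subseteq\mathbb{R}^{d_s}$ and $\mathcal{A}\subseteq\mathbb{R}^{d_a}$ are the state and action spaces, $\gamma\in[0,1)$ is the discount, and $\|\cdot\|$ is the Euclidean norm. Starting from an initial state $s_0$, a deterministic policy $\pi:\mathcal{S}\to\mathcal{A}$ generates in $\mathcal{M}$ the trajectory $a_t=\pi(s_t)$, $s_{t+1}=f(s_t,a_t)$, and its discounted return is $J(\pi,\mathcal{M}):=\sum_{t=0}^\infty\gamma^t r(s_t,a_t)$. The return $J(\pi,\hat{\mathcal{M}})$ is defined in the same way with $\hat f,\hat r$ in place of $f,r$, starting from the same initial state $s_0$. No Lipschitz assumption is made on $\hat f$ or $\hat r$. *)

(* Defs.v *)
From HB Require Import structures.
From mathcomp Require Import all_boot all_order all_algebra.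
From mathcomp Require Import all_classical all_reals all_analysis.

Set Implicit Arguments.
Unset Strict Implicit.
Unset Printing Implicit Defensive.

Import Order.TTheory GRing.Theory Num.Theory.
Import numFieldNormedType.Exports.

Local Open Scope classical_set_scope.
Local Open Scope ring_scope.

(* The canonical norm on 'rV[R]_d is the sup norm, hence a separate definition. *)
Definition eucl_norm (R : realType) (d : nat) (x : 'rV[R]_d) : R :=
  Num.sqrt (\sum_(i < d) x 0 i ^+ 2).

Definition eucl_dist (R : realType) (d : nat) (X : set 'rV[R]_d) (x y : X) : R :=
  eucl_norm (val x - val y).

(* The discount is a parameter so that two processes can share it by typing. *)
Record mdp (R : realType) (ds da : nat)
    (S : set 'rV[R]_ds) (A : set 'rV[R]_da) (gamma : R) := MDP {
  dynamics : S -> A -> S;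
  reward : S -> A -> R }.

Section Return.
Context (R : realType) (ds da : nat).
Context (S : set 'rV[R]_ds) (A : set 'rV[R]_da) (gamma : R).

Definition state_at (M : mdp S A gamma) (pi : S -> A) (s0 : S) (t : nat) : S :=
  iter t (fun s => dynamics M s (pi s)) s0.

Definition discounted_reward (M : mdp S A gamma) (pi : S -> A) (s0 : S)
    (t : nat) : R :=
  gamma ^+ t * reward M (state_at M pi s0 t) (pi (state_at M pi s0 t)).

(* lim is a total operator: the value is meaningful when this series converges. *)
Definition discounted_return (M : mdp S A gamma) (pi : S -> A) (s0 : S) : R :=
  limn (series (discounted_reward M pi s0)).

Definition dyn_errors (M Mhat : mdp S A gamma) : set R :=
  [set eucl_dist (dynamics Mhat p.1 p.2) (dynamics M p.1 p.2)
     | p in [set: S * A]].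

Definition rew_errors (M Mhat : mdp S A gamma) : set R :=
  [set `|reward Mhat p.1 p.2 - reward M p.1 p.2| | p in [set: S * A]].

End Return.

(* Main.v *)
Require Import Defs.
From HB Require Import structures.
From mathcomp Require Import all_boot all_order all_algebra.
From mathcomp Require Import all_classical all_reals all_analysis.
From mathcomp Require Import ring lra.

Set Implicit Arguments.
Unset Strict Implicit.
Unset Printing Implicit Defensive.

Import Order.TTheory GRing.Theory Num.Theory.
Import numFieldNormedType.Exports.

Local Open Scope classical_set_scope.
Local Open Scope ring_scope.

(** The gap [D t] between the trajectories satisfies [D 0 = 0] and
    [D t.+1 <= K * D t + eps] with [K = Lf * (1 + Lpi)]. Since [gamma * K < 1]
    the discounted sum of the gaps is bounded, although [D] itself may grow
    exponentially. Rewards along the two trajectories differ by at most a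
    constant plus [Lr * (1 + Lpi) * D t], which gives the bound. Convergence of
    the return of [M] is the same estimate against the trajectory frozen at
    [s0], whose one-step defect is the distance between [s0] and its successor. *)

Lemma eucl_norm_ge0 (R : realType) (d : nat) (x : 'rV[R]_d) : 0 <= eucl_norm x.
Proof. exact: sqrtr_ge0. Qed.

Lemma sqr_eucl_norm (R : realType) (d : nat) (x : 'rV[R]_d) :
  eucl_norm x ^+ 2 = \sum_(i < d) x 0 i ^+ 2.
Proof. by rewrite sqr_sqrtr// sumr_ge0// => i _; rewrite sqr_ge0. Qed.

Lemma eucl_norm_eq0 (R : realType) (d : nat) (x : 'rV[R]_d) :
  eucl_norm x = 0 -> x = 0.
Proof.
move=> x0; have /eqP := sqr_eucl_norm x; rewrite x0 expr0n eq_sym.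
rewrite psumr_eq0 => [/allP xi0|i _]; last exact: sqr_ge0.
apply/rowP => i; rewrite mxE; apply/eqP.
by have := xi0 i (mem_index_enum _); rewrite sqrf_eq0.
Qed.

Lemma eucl_norm0 (R : realType) (d : nat) : eucl_norm (0 : 'rV[R]_d) = 0.
Proof.
by rewrite /eucl_norm big1 ?sqrtr0// => i _; rewrite mxE expr0n.
Qed.

Lemma eucl_normN (R : realType) (d : nat) (x : 'rV[R]_d) :
  eucl_norm (- x) = eucl_norm x.
Proof.
by congr Num.sqrt; apply: eq_bigr => i _; rewrite mxE sqrrN.
Qed.

(** With [a], [b] the two norms, the squared norm of [b * x - a * y] expands to [2 * a * b] times
    the difference of the two sides. A zero norm forces a zero vector, so [a * b] can otherwise be
    cancelled. *)
Lemma eucl_cauchy_schwarz (R : realType) (d : nat) (x y : 'rV[R]_d) :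
  \sum_(i < d) x 0 i * y 0 i <= eucl_norm x * eucl_norm y.
Proof.
set a := eucl_norm x; set b := eucl_norm y.
have [a0|aN0] := eqVneq a 0.
  by rewrite a0 mul0r big1// => i _; rewrite (eucl_norm_eq0 a0) mxE mul0r.
have [b0|bN0] := eqVneq b 0.
  by rewrite b0 mulr0 big1// => i _; rewrite (eucl_norm_eq0 b0) mxE mulr0.
have ab0 : 0 < a * b by rewrite mulr_gt0 // lt_def eucl_norm_ge0 ?aN0 ?bN0.
have : 0 <= \sum_(i < d) (b * x 0 i - a * y 0 i) ^+ 2.
  by rewrite sumr_ge0// => i _; rewrite sqr_ge0.
have -> : \sum_(i < d) (b * x 0 i - a * y 0 i) ^+ 2 =
    b ^+ 2 * a ^+ 2 - 2 * (a * b) * (\sum_(i < d) x 0 i * y 0 i)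
      + a ^+ 2 * b ^+ 2.
  rewrite [X in b ^+ 2 * X]sqr_eucl_norm [X in a ^+ 2 * X]sqr_eucl_norm.
  rewrite !mulr_sumr -sumrB -big_split/=.
  by apply: eq_bigr => i _; ring.
move=> h; rewrite -(ler_pM2l ab0); nra.
Qed.

Lemma eucl_normD (R : realType) (d : nat) (x y : 'rV[R]_d) :
  eucl_norm (x + y) <= eucl_norm x + eucl_norm y.
Proof.
rewrite -ler_sqr ?nnegrE ?addr_ge0 ?eucl_norm_ge0//.
have -> : eucl_norm (x + y) ^+ 2 = eucl_norm x ^+ 2 + eucl_norm y ^+ 2
    + 2 * \sum_(i < d) x 0 i * y 0 i.
  rewrite !sqr_eucl_norm mulr_sumr -!big_split/=.
  by apply: eq_bigr => i _; rewrite mxE; ring.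
have := eucl_cauchy_schwarz x y; nra.
Qed.

Lemma eucl_dist_ge0 (R : realType) (d : nat) (X : set 'rV[R]_d) (x y : X) :
  0 <= eucl_dist x y.
Proof. exact: eucl_norm_ge0. Qed.

Lemma eucl_distxx (R : realType) (d : nat) (X : set 'rV[R]_d) (x : X) :
  eucl_dist x x = 0.
Proof. by rewrite /eucl_dist subrr eucl_norm0. Qed.

Lemma eucl_distC (R : realType) (d : nat) (X : set 'rV[R]_d) (x y : X) :
  eucl_dist x y = eucl_dist y x.
Proof. by rewrite /eucl_dist -eucl_normN opprB. Qed.

Lemma eucl_dist_triangle (R : realType) (d : nat) (X : set 'rV[R]_d)
    (y x z : X) :
  eucl_dist x z <= eucl_dist x y + eucl_dist y z.
Proof. by rewrite /eucl_dist -(subrKA (val y)) eucl_normD. Qed.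

Lemma geometric_sum_le (R : realType) (gamma : R) (n : nat) :
  0 <= gamma -> gamma < 1 ->
  \sum_(0 <= t < n) gamma ^+ t <= (1 - gamma)^-1.
Proof.
move=> g0 g1; have g1' : 0 < 1 - gamma by rewrite subr_gt0.
rewrite -[leRHS]mul1r ler_pdivlMr//.
elim: n => [|n IHn]; first by rewrite big_geq// mul0r.
(* The sum [G] of [n.+1] terms is one plus [gamma] times the sum of [n] terms, so
   [G * (1 - gamma) <= 1] propagates. *)
rewrite big_nat_recl// expr0.
under eq_bigr => t _ do rewrite exprS.
by rewrite -mulr_sumr; nra.
Qed.

(** The bound is the fixed point of the affine map sending [B] to [gamma * K * B + gamma * eps / (1
    - gamma)], and each new partial sum is at most the image of the previous one. *)
Lemma discounted_drift_sum_le (R : realType) (gamma K eps : R) (D : nat -> R)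
    (n : nat) :
  0 <= gamma -> gamma < 1 -> 0 <= K -> gamma * K < 1 -> 0 <= eps ->
  D 0%N = 0 -> (forall t, D t.+1 <= K * D t + eps) ->
  \sum_(0 <= t < n) gamma ^+ t * D t
    <= gamma * eps / ((1 - gamma) * (1 - gamma * K)).
Proof.
move=> g0 g1 K0 gK1 e0 D0 DS; set B := _ / _.
have gK0 : 0 <= gamma * K by rewrite mulr_ge0.
have B_fix : B = gamma * K * B + gamma * eps * (1 - gamma)^-1.
  by rewrite /B; field; rewrite !subr_eq0 !gt_eqF.
elim: n => [|n IHn].
  rewrite big_geq// divr_ge0 ?mulr_ge0// subr_ge0; exact: ltW.
(* Splitting off the vanishing first term leaves only terms in [D t.+1], to which the recursion
   applies. *)
rewrite big_nat_recl// D0 mulr0 add0r B_fix.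
apply: (@le_trans _ _ (gamma * K * (\sum_(0 <= t < n) gamma ^+ t * D t)
    + gamma * eps * (\sum_(0 <= t < n) gamma ^+ t))).
  rewrite !mulr_sumr -big_split/=; apply: ler_sum => t _.
  rewrite exprS.
  have := ler_wpM2l (mulr_ge0 g0 (exprn_ge0 t g0)) (DS t); lra.
apply: lerD; first exact: ler_wpM2l.
by rewrite ler_wpM2l ?mulr_ge0// geometric_sum_le.
Qed.

Lemma abs_bounded_series (R : realType) (u : R^nat) (C : R) :
  (forall n, \sum_(0 <= t < n) `|u t| <= C) ->
  cvgn (series u) /\ `|limn (series u)| <= C.
Proof.
move=> uC; have cu : cvgn [normed series u].
  apply: nondecreasing_is_cvgn.
    by apply: nondecreasing_series => k _ _; exact: normr_ge0.
  by exists C => _ [n _ <-]; exact: uC.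
split; first exact: normed_cvg.
apply: le_trans (lim_series_norm cu) _.
by apply: limr_le => //; near=> n; exact: uC.
Unshelve. all: by end_near. Qed.

(** Here [y] and [rho] are arbitrary sequences, so that both a frozen state and the trajectory of
    another process fit. The conclusion concerns the series of differences because neither series is
    yet known to converge. *)
Lemma perturbed_return (R : realType) (ds da : nat)
    (S : set 'rV[R]_ds) (A : set 'rV[R]_da) (gamma : R) (M : mdp S A gamma)
    (Lf Lr Lpi eps b : R) (pi : S -> A) (s0 : S) (y : nat -> S) (rho : R^nat) :
  0 <= gamma -> gamma < 1 -> 0 <= Lf -> 0 <= Lr -> 0 <= Lpi ->
  gamma * Lf * (1 + Lpi) < 1 ->
  (forall (s s' : S) (a a' : A),
    eucl_dist (dynamics M s a) (dynamics M s' a')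
      <= Lf * (eucl_dist s s' + eucl_dist a a')) ->
  (forall (s s' : S) (a a' : A),
    `|reward M s a - reward M s' a'|
      <= Lr * (eucl_dist s s' + eucl_dist a a')) ->
  (forall s s' : S, eucl_dist (pi s) (pi s') <= Lpi * eucl_dist s s') ->
  y 0%N = s0 ->
  (forall t, eucl_dist (dynamics M (y t) (pi (y t))) (y t.+1) <= eps) ->
  (forall t, `|reward M (y t) (pi (y t)) - rho t| <= b) ->
  let gap := discounted_reward M pi s0 - (fun t => gamma ^+ t * rho t) in
  cvgn (series gap) /\
  `|limn (series gap)| <= 1 / (1 - gamma) * b
    + gamma * Lr * (1 + Lpi)
      / ((1 - gamma) * (1 - gamma * Lf * (1 + Lpi))) * eps.
Proof.
move=> g0 g1 Lf0 Lr0 Lpi0 gK1 f_lip r_lip pi_lip y0 y_step y_rew gap.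
have eps0 : 0 <= eps := le_trans (eucl_dist_ge0 _ _) (y_step 0%N).
have b0 : 0 <= b := le_trans (normr_ge0 _) (y_rew 0%N).
pose x := state_at M pi s0; pose D t := eucl_dist (x t) (y t).
have lip_pi s s' : eucl_dist s s' + eucl_dist (pi s) (pi s')
    <= (1 + Lpi) * eucl_dist s s' by have := pi_lip s s'; lra.
have D0 : D 0%N = 0 by rewrite /D y0 eucl_distxx.
have DS t : D t.+1 <= Lf * (1 + Lpi) * D t + eps.
  (* The intermediate point is the [M]-successor of [y t]: one leg is Lipschitz, the other is the
     defect of [y]. *)
  apply: le_trans (eucl_dist_triangle (dynamics M (y t) (pi (y t))) _ _) _.
  apply: lerD (y_step t); rewrite -mulrA.
  exact: le_trans (f_lip _ _ _ _) (ler_wpM2l Lf0 (lip_pi _ _)).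
apply: abs_bounded_series => n.
apply: (@le_trans _ _ (b * (\sum_(0 <= t < n) gamma ^+ t)
    + Lr * (1 + Lpi) * (\sum_(0 <= t < n) gamma ^+ t * D t))).
  rewrite !mulr_sumr -big_split/=; apply: ler_sum => t _.
  rewrite /gap/= /discounted_reward -mulrBr normrM ger0_norm ?exprn_ge0//.
  have r_gap : `|reward M (x t) (pi (x t)) - rho t|
      <= b + Lr * (1 + Lpi) * D t.
    apply: le_trans (ler_distD (reward M (y t) (pi (y t))) _ _) _.
    rewrite addrC -mulrA; apply: lerD (y_rew t) _.
    exact: le_trans (r_lip _ _ _ _) (ler_wpM2l Lr0 (lip_pi _ _)).
  by have := ler_wpM2l (exprn_ge0 t g0) r_gap; rewrite -/x; lra.
apply: lerD; first by rewrite mul1r mulrC ler_wpM2r// geometric_sum_le.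
have K0 : 0 <= Lf * (1 + Lpi) by rewrite mulr_ge0// addr_ge0.
rewrite -mulrA in gK1 *.
have := discounted_drift_sum_le n g0 g1 K0 gK1 eps0 D0 DS.
move=> /(ler_wpM2l (mulr_ge0 Lr0 (addr_ge0 ler01 Lpi0))).
by move/le_trans; apply; rewrite le_eqVlt; apply/orP; left; apply/eqP; ring.
Qed.

Theorem lemma1 (R : realType) (ds da : nat)
    (S : set 'rV[R]_ds) (A : set 'rV[R]_da) (gamma : R)
    (gamma_ge0 : 0 <= gamma) (gamma_lt1 : gamma < 1)
    (M Mhat : mdp S A gamma)
    (Lf Lr : R) (Lf_ge0 : 0 <= Lf) (Lr_ge0 : 0 <= Lr)
    (dynamics_lip : forall (s s' : S) (a a' : A),
      eucl_dist (dynamics M s a) (dynamics M s' a')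
        <= Lf * (eucl_dist s s' + eucl_dist a a'))
    (reward_lip : forall (s s' : S) (a a' : A),
      `|reward M s a - reward M s' a'|
        <= Lr * (eucl_dist s s' + eucl_dist a a'))
    (Lpi : R) (Lpi_ge0 : 0 <= Lpi)
    (contract : gamma * Lf * (1 + Lpi) < 1)
    (dyn_errors_bounded : has_ubound (dyn_errors M Mhat))
    (rew_errors_bounded : has_ubound (rew_errors M Mhat)) :
  let eps_dyn := sup (dyn_errors M Mhat) in
  let eps_rew := sup (rew_errors M Mhat) in
  forall (pi : S -> A),
    (forall s s' : S, eucl_dist (pi s) (pi s') <= Lpi * eucl_dist s s') ->
  forall s0 : S,
    [/\ cvgn (series (discounted_reward M pi s0)),
        cvgn (series (discounted_reward Mhat pi s0)) &
        `|discounted_return M pi s0 - discounted_return Mhat pi s0|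
          <= 1 / (1 - gamma) * eps_rew
             + gamma * Lr * (1 + Lpi)
               / ((1 - gamma) * (1 - gamma * Lf * (1 + Lpi))) * eps_dyn].
Proof.
move=> eps_dyn eps_rew pi pi_lip s0.
have bound y rho eps b := @perturbed_return _ _ _ _ _ _ M Lf Lr Lpi eps b pi s0
  y rho gamma_ge0 gamma_lt1 Lf_ge0 Lr_ge0 Lpi_ge0 contract dynamics_lip
  reward_lip pi_lip.
have cvgM : cvgn (series (discounted_reward M pi s0)).
  pose r0 := reward M s0 (pi s0).
  have [||t|cvg_gap _] := @bound (fun=> s0) (fun=> r0)
      (eucl_dist (dynamics M s0 (pi s0)) s0) 0.
  - by [].
  - by [].
  - by rewrite subrr normr0.
  have cvg_r0 : cvgn (series (fun t => gamma ^+ t * r0)).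
    have -> : (fun t => gamma ^+ t * r0) = geometric r0 gamma.
      by apply/funext => t; rewrite /= mulrC.
    by apply: is_cvg_geometric_series; rewrite ger0_norm.
  by have := is_cvg_seriesD cvg_gap cvg_r0; rewrite subrK.
have [||t|] := @bound (state_at Mhat pi s0)
    (fun t => reward Mhat (state_at Mhat pi s0 t) (pi (state_at Mhat pi s0 t)))
    eps_dyn eps_rew.
- by [].
(* The defect of the [Mhat]-trajectory at time [t] is, up to symmetry, one of the errors under the
   supremum. *)
- move=> t; rewrite eucl_distC; apply: ub_le_sup => //.
  by exists (state_at Mhat pi s0 t, pi (state_at Mhat pi s0 t)).
- rewrite distrC; apply: ub_le_sup => //.
  by exists (state_at Mhat pi s0 t, pi (state_at Mhat pi s0 t)).
rewrite -/(discounted_reward Mhat pi s0) => cvg_gap gap_le.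
(* Convergence passes from [M] to [Mhat] by subtracting the gap series. *)
have cvgMhat : cvgn (series (discounted_reward Mhat pi s0)).
  by have := is_cvg_seriesB cvgM cvg_gap; rewrite subKr.
by split=> //; rewrite /discounted_return -lim_seriesB.
Qed.
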